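(* Let $(X,d_X)$ be a path metric space. Then the persistence diagram of $\mathrm{H}_1(\mathbb{R}\mathrm{ips}(X))$ is contained in the vertical line $\{0 \} \times [0,+\infty)$.
   Context: $\mathrm{H}_1$ is simplicial homology with coefficients in a fixed field $\mathbf{k}$. A metric space $(X,d_X)$ is a path metric space if the distance between each pair of points equals the infimum of the lengths of the curves joining these two points. For $a\in\mathbf{R}$, $\mathrm{Rips}(X,a)$ is the simplicial complex whose simplices are the nonempty finite subsets $\{x_0,\dots,x_k\}\subseteq X$ with $d_X(x_i,x_j)\le a$ for all $i,j$. $\mathrm{H}_1(\mathbb{R}\mathrm{ips}(X))$ is the persistence module $\mathbb{V}$ with $V_a=\mathrm{H}_1(\mathrm{Rips}(X,a))$, $a\in\mathbf{R}$, and maps $v_a^b:V_a\to V_b$ ($a\le b$) induced by inclusions. Total boundedness of $X$ is not assumed, so $\mathbb{V}$ need not satisfy any finiteness condition. Persistence diagram (measure-theoretic definition): for $-\infty\le p<q<r<s\le+\infty$ and the rectangle $R=[p,q]\times[r,s]$, let $\mu(R)\in\{0,1,2,\dots,\infty\}$ be the multiplicity, in the decomposition of the diagram $V_p\to V_q\to V_r\to V_s$ into interval summands, of the interval summand supported exactly at positions $q,r$ (with $V_{\pm\infty}=0$); explicitly $\mu(R)=\dim\big[(\mathrm{im}\,v_q^r\cap\ker v_r^s)/(\mathrm{im}\,v_p^r\cap\ker v_r^s)\big]$. The diagram is defined wherever $\mu$ takes finite values, the multiplicity of a point being the minimum of $\mu(R)$ over rectangles $R$ containing it in their interior (relative to the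 extended plane). The diagram is said to be contained in a set $A$ when $\mu(R)=0$ for every rectangle $R=[p,q]\times[r,s]$ with $-\infty\le p<q<r<s\le+\infty$ that does not meet $A$, so that the diagram is defined, and empty, away from $A$. *)

(* Defs.v *)
From HB Require Import structures.
From mathcomp Require Import all_boot all_order all_algebra perm finmap.
From mathcomp Require Import generic_quotient ring_quotient.
From mathcomp Require Import all_classical all_reals all_analysis.
From mathcomp Require Import zify.
From mathcomp.multinomials Require Import freeg.

Set Implicit Arguments.
Unset Strict Implicit.
Unset Printing Implicit Defensive.

Import Order.TTheory GRing.Theory Num.Theory.
Import numFieldNormedType.Exports.

Local Open Scope classical_set_scope.
Local Open Scope ring_scope.
Local Open Scope quotient_scope.

Section Subspaces.
Context (k : fieldType).
Implicit Types U V W : lmodType k.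

Definition ker U V (f : {linear U -> V}) : {pred U} := fun u => f u == 0.

Lemma ker_submod U V (f : {linear U -> V}) : submod_closed (ker f).
Proof.
split=> [|a u v]; rewrite !unfold_in; first by rewrite linear0.
by move=> /eqP fu /eqP fv; rewrite linearP fu fv scaler0 addr0.
Qed.

HB.instance Definition _ U V (f : {linear U -> V}) :=
  GRing.isSubmodClosed.Build k U (ker f) (ker_submod f).

Definition im U V (f : {linear U -> V}) : {pred V} :=
  fun v => `[< exists u, f u = v >].

Lemma im_submod U V (f : {linear U -> V}) : submod_closed (im f).
Proof.
split=> [|a _ _ /asboolP[u <-] /asboolP[v <-]]; apply/asboolP.
  by exists 0; rewrite linear0.
by exists (a *: u + v); rewrite linearP.
Qed.

HB.instance Definition _ U V (f : {linear U -> V}) :=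
  GRing.isSubmodClosed.Build k V (im f) (im_submod f).

Definition cap V (S T : submodClosed V) : {pred V} :=
  fun v => (v \in S) && (v \in T).

Lemma cap_submod V (S T : submodClosed V) : submod_closed (cap S T).
Proof.
split=> [|a u v /andP[uS uT] /andP[vS vT]]; apply/andP.
  by rewrite !rpred0.
by rewrite !rpredD ?rpredZ.
Qed.

HB.instance Definition _ V (S T : submodClosed V) :=
  GRing.isSubmodClosed.Build k V (cap S T) (cap_submod S T).

Definition preim U V (f : {linear U -> V}) (S : submodClosed V) : {pred U} :=
  fun u => f u \in S.

Lemma preim_submod U V (f : {linear U -> V}) (S : submodClosed V) :
  submod_closed (preim f S).
Proof.
have E u : (u \in preim f S) = (f u \in S) by [].
split=> [|a u v]; rewrite !E; first by rewrite linear0 rpred0.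
by move=> fu fv; rewrite linearP rpredD ?rpredZ.
Qed.

HB.instance Definition _ U V (f : {linear U -> V}) (S : submodClosed V) :=
  GRing.isSubmodClosed.Build k U (preim f S) (preim_submod f S).

Definition span V (A : set V) : {pred V} :=
  fun v => `[< forall S : submodClosed V, (forall a, A a -> a \in S) -> v \in S >].

Lemma span_submod V (A : set V) : submod_closed (span A).
Proof.
split=> [|a u v /asboolP uA /asboolP vA]; apply/asboolP => S AS.
  exact: rpred0.
by rewrite rpredD ?rpredZ ?uA ?vA.
Qed.

HB.instance Definition _ V (A : set V) :=
  GRing.isSubmodClosed.Build k V (span A) (span_submod A).

Lemma mem_span V (A : set V) a : A a -> a \in span A.
Proof. by move=> Aa; apply/asboolP => S; apply. Qed.

Lemma span_min V (A : set V) (S : submodClosed V) :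
  (forall a, A a -> a \in S) -> forall v, v \in span A -> v \in S.
Proof. by move=> AS v /asboolP; apply. Qed.

End Subspaces.

Section SubSpace.
Context (k : fieldType) (V : lmodType k) (S : submodClosed V).

Definition sub_space := {v : V | v \in S}.

HB.instance Definition _ := SubChoice.on sub_space.
HB.instance Definition _ := [SubChoice_isSubLmodule of sub_space by <:].

Definition sub_val : sub_space -> V := val.

HB.instance Definition _ := GRing.Linear.on sub_val.

End SubSpace.

Section QuotientSpace.
Context (k : fieldType) (V : lmodType k) (S : submodClosed V).

Definition quot_pred : {pred V} := fun v => v \in S.

Lemma quot_pred_zmod : zmod_closed quot_pred.
Proof.
split=> [|x y xS yS]; rewrite unfold_in; first exact: rpred0.
by rewrite rpredD// -scaleN1r rpredZ.
Qed.

HB.instance Definition _ := GRing.isZmodClosed.Build V quot_pred quot_pred_zmod.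

Definition quot_space := Quotient.quot (quot_pred : zmodClosed V).

HB.instance Definition _ := GRing.Zmodule.on quot_space.
HB.instance Definition _ := EqQuotient.on quot_space.

Definition to_quot (v : V) : quot_space := \pi_quot_space v.

Lemma to_quotP v w : to_quot v = to_quot w <-> v - w \in S.
Proof.
rewrite /to_quot; split=> [/eqP|vw]; last apply/eqP;
  by rewrite -Quotient.idealrBE.
Qed.

Lemma to_quot_repr x : to_quot (repr x) = x.
Proof. exact: reprK. Qed.

Definition quot_scale (a : k) (x : quot_space) : quot_space :=
  to_quot (a *: repr x).

Lemma quot_scaleE a v : quot_scale a (to_quot v) = to_quot (a *: v).
Proof.
apply/to_quotP; rewrite -scalerBr rpredZ//; apply/to_quotP.
exact: to_quot_repr.
Qed.

Lemma to_quotD v w : to_quot (v + w) = to_quot v + to_quot w.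
Proof. by rewrite /to_quot piE. Qed.

Lemma quot_scaleA a b x : quot_scale a (quot_scale b x) = quot_scale (a * b) x.
Proof. by rewrite -[x]to_quot_repr !quot_scaleE scalerA. Qed.

Lemma quot_scale1 : left_id 1 quot_scale.
Proof. by move=> x; rewrite -[x]to_quot_repr quot_scaleE scale1r. Qed.

Lemma quot_scaleDr : right_distributive quot_scale +%R.
Proof.
move=> a x y; rewrite -[x]to_quot_repr -[y]to_quot_repr.
by rewrite -to_quotD !quot_scaleE scalerDr to_quotD.
Qed.

Lemma quot_scaleDl x : {morph quot_scale^~ x : a b / a + b}.
Proof.
by move=> a b; rewrite -[x]to_quot_repr !quot_scaleE scalerDl to_quotD.
Qed.

HB.instance Definition _ := GRing.Zmodule_isLmodule.Build k quot_space
  quot_scaleA quot_scale1 quot_scaleDr quot_scaleDl.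

Lemma to_quot_is_linear : linear to_quot.
Proof. by move=> a v w; rewrite to_quotD -quot_scaleE. Qed.

HB.instance Definition _ :=
  GRing.isLinear.Build k V quot_space _ to_quot to_quot_is_linear.

End QuotientSpace.

Arguments to_quot {k V} S v.

Section InducedMaps.
Context (k : fieldType) (U V : lmodType k).
Context (f : {linear U -> V}) (S : submodClosed U) (T : submodClosed V).
Hypothesis fST : forall u, u \in S -> f u \in T.

Definition sub_map (u : sub_space S) : sub_space T :=
  exist _ (f (val u)) (fST (valP u)).

Lemma sub_map_is_linear : linear sub_map.
Proof. by move=> a u v; apply/val_inj; rewrite /= linearP. Qed.

HB.instance Definition _ := GRing.isLinear.Build k (sub_space S) (sub_space T) _
  sub_map sub_map_is_linear.

(* fST makes the value independent of the representative: quot_mapE *)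
Definition quot_map (fST : forall u, u \in S -> f u \in T) (x : quot_space S) :
  quot_space T := to_quot T (f (repr x)).

Lemma quot_mapE u : quot_map fST (to_quot S u) = to_quot T (f u).
Proof.
by apply/to_quotP; rewrite -linearB fST//; apply/to_quotP; rewrite to_quot_repr.
Qed.

Lemma quot_map_is_linear : linear (quot_map fST).
Proof.
move=> a x y; rewrite -[x]to_quot_repr -[y]to_quot_repr -linearP.
by rewrite !quot_mapE -!linearP.
Qed.

HB.instance Definition _ := GRing.isLinear.Build k (quot_space S) (quot_space T) _
  (quot_map fST) quot_map_is_linear.

End InducedMaps.

Arguments sub_map {k U V} f {S T} fST u.
Arguments quot_map {k U V} f {S T} fST x.

Section Dimension.
Context (R : realType) (k : fieldType) (V : lmodType k).

Definition lin_indep n (e : 'I_n -> V) :=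
  forall c : 'I_n -> k, \sum_(i < n) c i *: e i = 0 -> forall i, c i = 0.

(* The dimension of V, +oo when V is infinite-dimensional. *)
Definition dimension : \bar R :=
  ereal_sup [set n%:R%:E | n in [set n | exists e : 'I_n -> V, lin_indep e]].

End Dimension.

(* The homology at V of U -d1-> V -d0-> W. No hypothesis d0 \o d1 = 0 is needed
   since im d1 is pulled back to the cycles; see boundaryK for chain complexes. *)
Section Homology.
Context (k : fieldType) (U V W : lmodType k).
Context (d1 : {linear U -> V}) (d0 : {linear V -> W}).

Definition cycles := sub_space (ker d0).

HB.instance Definition _ := GRing.Lmodule.on cycles.

Definition boundaries : {pred cycles} := preim (@sub_val k V (ker d0)) (im d1).

HB.instance Definition _ := GRing.SubmodClosed.on boundaries.

Definition homology := quot_space boundaries.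

HB.instance Definition _ := GRing.Lmodule.on homology.

End Homology.

Arguments boundaries {k U V W} d1 d0 _.

Section HomologyMap.
Context (k : fieldType) (U V W U' V' W' : lmodType k).
Context (d1 : {linear U -> V}) (d0 : {linear V -> W}).
Context (d1' : {linear U' -> V'}) (d0' : {linear V' -> W'}).
Context (fU : {linear U -> U'}) (fV : {linear V -> V'}) (fW : {linear W -> W'}).
Hypothesis f1 : forall u, fV (d1 u) = d1' (fU u).
Hypothesis f0 : forall v, fW (d0 v) = d0' (fV v).

Lemma cycles_subproof v : v \in ker d0 -> fV v \in ker d0'.
Proof. by rewrite !unfold_in -f0 => /eqP ->; rewrite linear0. Qed.

Definition cycles_map : cycles d0 -> cycles d0' := sub_map fV cycles_subproof.

HB.instance Definition _ := GRing.Linear.on cycles_map.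

Lemma boundaries_subproof z :
  z \in boundaries d1 d0 -> cycles_map z \in boundaries d1' d0'.
Proof.
move=> /asboolP[u uz]; apply/asboolP; exists (fU u).
by rewrite -f1 uz.
Qed.

Definition homology_map : homology d1 d0 -> homology d1' d0' :=
  quot_map cycles_map boundaries_subproof.

HB.instance Definition _ := GRing.Linear.on homology_map.

Lemma homology_mapE z :
  homology_map (to_quot (boundaries d1 d0) z) =
  to_quot (boundaries d1' d0') (cycles_map z).
Proof. exact: quot_mapE. Qed.

End HomologyMap.

Record simplicial_complex (X : choiceType) := SimplicialComplex {
  simplex : set {fset X};
  simplex_neq0 : forall A, simplex A -> A != fset0;
  simplex_sub : forall A B, simplex A -> (B `<=` A)%fset -> B != fset0 -> simplex B
}.

Section FreeModule.
Context (k : fieldType) (T : choiceType).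

Definition free := {freeg T / k}.

HB.instance Definition _ := GRing.Lmodule.on free.

Definition gen (t : T) : free := << t >>.

Lemma free_ind (P : free -> Prop) :
  P 0 -> (forall a t c, P c -> P (a *: gen t + c)) -> forall c, P c.
Proof.
move=> P0 PD c; rewrite -[c]freeg_sumE.
elim: (dom c) => [|t s IH]; rewrite ?big_nil// big_cons.
suff -> : << coeff t c *g t >> = coeff t c *: gen t by exact: PD.
by apply/eqP/freeg_eqP => y; rewrite coeffZ !coeffU mul1r.
Qed.

Section LinearExtension.
Context (M : lmodType k) (f : T -> M).

Definition lin_ext : free -> M := fglift f.

Lemma lin_ext_linear : linear lin_ext.
Proof.
pose g : {additive free -> M} :=
  HB.pack lin_ext
    (GRing.isZmodMorphism.Build _ _ lin_ext (@lift_is_additive k T M f)).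
have gE : lin_ext = g by [].
have lin_extZ a D : lin_ext (a *: D) = a *: lin_ext D.
  rewrite -[D]freeg_sumE scaler_sumr gE !raddf_sum.
  apply: eq_bigr => x _; rewrite -gE.
  have -> : a *: << coeff x D *g x >> = << a * coeff x D *g x >>.
    by apply/eqP/freeg_eqP => y; rewrite coeff_fgscale !coeffU mulrA.
  by rewrite /lin_ext !liftU /= scalerA.
by move=> a D E; rewrite -lin_extZ gE raddfD.
Qed.

HB.instance Definition _ :=
  GRing.isLinear.Build k free M _ lin_ext lin_ext_linear.

Lemma lin_extE t : lin_ext (gen t) = f t.
Proof. by rewrite /lin_ext liftU scale1r. Qed.

End LinearExtension.

End FreeModule.

Arguments gen k {T} t.

Section OrientedChains.
Context (k : fieldType) (X : choiceType).
Implicit Types K L : simplicial_complex X.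

(* The (n+1)-tuples of vertices, possibly repeated, of a simplex of K. *)
Definition tuples_in K n : set (n.+1.-tuple X) :=
  [set t : n.+1.-tuple X | simplex K [fset x in (t : seq X)]%fset].

Arguments tuples_in K n : clear implicits.

Definition free_chains K n := free k (tuples_in K n).

HB.instance Definition _ K n := GRing.Lmodule.on (free_chains K n).

Local Notation gen := (gen k).

Lemma retuple_subproof K n m (f : 'I_m.+1 -> 'I_n.+1) (t : tuples_in K n) :
  [tuple tnth (val t) (f i) | i < m.+1] \in tuples_in K m.
Proof.
case: t => t /=; rewrite !inE /tuples_in /= => Kt.
apply: simplex_sub Kt _ _.
  apply/fsubsetP => x; rewrite !inE => /mapP[i _ ->]; exact: mem_tnth.
apply/fset0Pn; exists (tnth t (f ord0)).
by rewrite !inE; apply/mapP; exists ord0 => //; rewrite mem_enum.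
Qed.

Definition retuple K n m (f : 'I_m.+1 -> 'I_n.+1) (t : tuples_in K n) :
  tuples_in K m := exist (fun u => u \in tuples_in K m) _ (retuple_subproof f t).

Definition face K n (i : 'I_n.+2) : tuples_in K n.+1 -> tuples_in K n :=
  retuple (fintype.lift i).

(* An oriented simplex changes sign under odd permutations of its vertices and
   vanishes when a vertex is repeated; the second condition does not follow from
   the first in characteristic 2. *)
Definition orientation_relations K n : set (free_chains K n) :=
  [set c | (exists2 t : tuples_in K n, ~~ uniq (val t) & c = gen t)
        \/ (exists (s : 'S_n.+1) (t : tuples_in K n),
              c = gen (retuple s t) - (-1) ^+ s *: gen t)].

Definition chains K n := quot_space (span (@orientation_relations K n)).

HB.instance Definition _ K n := GRing.Lmodule.on (chains K n).

Definition oriented K n (t : tuples_in K n) : chains K n :=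
  to_quot (span (@orientation_relations K n)) (gen t).

Lemma oriented_nuniq K n (t : tuples_in K n) : ~~ uniq (val t) -> oriented t = 0.
Proof.
move=> tu; rewrite -(linear0 (to_quot _)); apply/to_quotP; rewrite subr0.
by apply: mem_span; left; exists t.
Qed.

Lemma oriented_perm K n (s : 'S_n.+1) (t : tuples_in K n) :
  oriented (retuple s t) = (-1) ^+ s *: oriented t.
Proof.
rewrite /oriented -linearZ; apply/to_quotP.
by apply: mem_span; right; exists s, t.
Qed.

Definition free_boundary K n : free_chains K n.+1 -> free_chains K n :=
  lin_ext (fun t => \sum_(i < n.+2) (-1) ^+ i *: gen (face i t)).

HB.instance Definition _ K n := GRing.Linear.on (@free_boundary K n).

Lemma oriented_face_perm K n (s : 'S_n.+2) (t : tuples_in K n.+1) (i : 'I_n.+2) :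
  (-1) ^+ i *: oriented (face i (retuple s t)) =
  (-1) ^+ s *: ((-1) ^+ s i *: oriented (face (s i) t)).
Proof.
pose f (j : 'I_n.+1) := odflt j (unlift (s i) (s (fintype.lift i j))).
have fE j : fintype.lift (s i) (f j) = s (fintype.lift i j).
  rewrite /f; case: unliftP => //= /perm_inj/eqP.
  by rewrite eq_sym (negPf (neq_lift _ _)).
have f_inj : injective f.
  by move=> a b /(congr1 (fintype.lift (s i))); rewrite !fE => /perm_inj/lift_inj.
have sE : s = lift_perm i (s i) (perm f_inj).
  apply/permP => j; case: (unliftP i j) => [j' ->|->].
    by rewrite lift_perm_lift permE fE.
  by rewrite lift_perm_id.
have -> : face i (retuple s t) = retuple (perm f_inj) (face (s i) t).
  apply: val_inj; apply: eq_from_tnth => j /=.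
  by rewrite !tnth_mktuple permE fE.
rewrite oriented_perm !scalerA; congr (_ *: _).
have -> : odd_perm s = odd i (+) odd (s i) (+) odd_perm (perm f_inj).
  by rewrite {1}sE odd_lift_perm.
rewrite -(signr_odd _ i) -(signr_odd _ (s i)).
by case: (odd i); case: (odd (s i)); case: odd_perm;
  rewrite ?expr1 ?expr0 ?mulrNN ?mulN1r ?mul1r ?mulr1.
Qed.

Lemma free_boundary_subproof K n c :
  c \in span (@orientation_relations K n.+1) ->
  free_boundary c \in span (@orientation_relations K n).
Proof.
pose q := to_quot (span (@orientation_relations K n)).
have qP c' : q c' = 0 -> c' \in span (@orientation_relations K n).
  by rewrite -(linear0 (to_quot _)) => /to_quotP; rewrite subr0.
have qb t :
    q (free_boundary (gen t)) = \sum_(i < n.+2) (-1) ^+ i *: oriented (face i t).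
  rewrite /q /free_boundary lin_extE linear_sum; apply: eq_bigr => i _.
  by rewrite linearZ.
move: c; apply: (@span_min _ _ _ (preim (@free_boundary K n) _)) => c cr.
have qbP : linear (fun c => q (free_boundary c)).
  by move=> b c1 c2; rewrite /q !linearP.
have qbB (s : 'S_n.+2) c1 c2 :
    q (free_boundary (c1 - (-1) ^+ s *: c2)) =
    q (free_boundary c1) - (-1) ^+ s *: q (free_boundary c2).
  by rewrite addrC -scaleNr qbP scaleNr addrC.
rewrite unfold_in; apply: (qP (free_boundary c)).
case: cr => [[t tu ->]|[s [t ->]]]; last first.
  rewrite qbB !qb.
  apply/eqP; rewrite subr_eq0; apply/eqP.
  rewrite [in RHS](reindex_inj (@perm_inj _ s)) /= scaler_sumr.
  by apply: eq_bigr => i _; exact: oriented_face_perm.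
have [a [b [ab tab]]] : exists a b, a != b /\ tnth (val t) a = tnth (val t) b.
  pose x0 : X := tnth (val t) ord0.
  have /(uniqPn x0)[a [b [ab bt tab]]] := tu; rewrite size_tuple in bt.
  have aB := ltn_trans ab bt.
  exists (Ordinal aB), (Ordinal bt); rewrite -val_eqE /= (ltn_eqF ab); split=> //.
  by rewrite !(tnth_nth x0).
rewrite qb (bigD1 a)//= (bigD1 b)/=; last by rewrite eq_sym.
rewrite big1 ?addr0; last first.
  move=> i /andP[ia ib]; rewrite oriented_nuniq ?scaler0//.
  have [a' aE _] := unlift_some ia; have [b' bE _] := unlift_some ib.
  apply: contraNN ab => /tuple_uniqP/(_ a' b') fab.
  by rewrite aE bE fab// !tnth_mktuple -aE -bE.
have tE : retuple (tperm a b) t = t.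
  apply: val_inj; apply: eq_from_tnth => j /=; rewrite tnth_mktuple.
  by case: tpermP => [->|->|].
rewrite -{1}tE oriented_face_perm tpermL odd_tperm ab/= expr1 scaleN1r.
by rewrite addNr.
Qed.

Definition boundary K n : chains K n.+1 -> chains K n :=
  quot_map (@free_boundary K n) (@free_boundary_subproof K n).

HB.instance Definition _ K n := GRing.Linear.on (@boundary K n).

Definition H1 K := homology (@boundary K 1) (@boundary K 0).

HB.instance Definition _ K := GRing.Lmodule.on (H1 K).

Lemma include_subproof K L n (KL : simplex K `<=` simplex L) (t : tuples_in K n) :
  val t \in tuples_in L n.
Proof. by case: t => t /= /[!inE]; exact: KL. Qed.

Definition include K L n (KL : simplex K `<=` simplex L) (t : tuples_in K n) :
  tuples_in L n := exist (fun u => u \in tuples_in L n) _ (include_subproof KL t).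

Definition free_map K L (KL : simplex K `<=` simplex L) n :
  free_chains K n -> free_chains L n := lin_ext (fun t => gen (include KL t)).

HB.instance Definition _ K L (KL : simplex K `<=` simplex L) n :=
  GRing.Linear.on (@free_map K L KL n).

Lemma free_map_subproof K L (KL : simplex K `<=` simplex L) n c :
  c \in span (@orientation_relations K n) ->
  free_map KL c \in span (@orientation_relations L n).
Proof.
move: c; apply: (@span_min _ _ _ (preim (@free_map K L KL n) _)) => c cr.
have mapP : linear (@free_map K L KL n) by exact: linearP.
have mapE u : free_map KL (gen u) = gen (include KL u) by exact: lin_extE.
rewrite unfold_in; apply: (@mem_span _ _ _ (free_map KL c)).
case: cr => [[t tu ->]|[s [t ->]]].
  by left; exists (include KL t); rewrite ?mapE.
right; exists s, (include KL t).
rewrite addrC -scaleNr mapP scaleNr addrC !mapE.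
by congr (gen _ - _); exact: val_inj.
Qed.

Definition chain_map K L (KL : simplex K `<=` simplex L) n :
  chains K n -> chains L n :=
  quot_map (@free_map K L KL n) (@free_map_subproof K L KL n).

HB.instance Definition _ K L (KL : simplex K `<=` simplex L) n :=
  GRing.Linear.on (@chain_map K L KL n).

Lemma chain_map_oriented K L (KL : simplex K `<=` simplex L) n (t : tuples_in K n) :
  chain_map KL (oriented t) = oriented (include KL t).
Proof.
rewrite /chain_map /oriented quot_mapE.
by congr (to_quot _ _); exact: lin_extE.
Qed.

Lemma boundary_oriented K n (t : tuples_in K n.+1) :
  boundary (oriented t) = \sum_(i < n.+2) (-1) ^+ i *: oriented (face i t).
Proof.
rewrite /boundary /oriented quot_mapE.
transitivity (to_quot (span (@orientation_relations K n))
  (\sum_(i < n.+2) (-1) ^+ i *: gen (face i t))).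
  by congr (to_quot _ _); exact: lin_extE.
by rewrite linear_sum; apply: eq_bigr => i _; rewrite linearZ.
Qed.

Lemma eq_on_oriented K n (V : lmodType k) (f g : {linear chains K n -> V}) :
  (forall t, f (oriented t) = g (oriented t)) -> f =1 g.
Proof.
move=> fg x; rewrite -[x]to_quot_repr; move: (repr x); apply: free_ind.
  by rewrite !linear0.
by move=> a t c IH; rewrite !linearP IH; congr (_ *: _ + _); exact: fg.
Qed.

Lemma boundary_chain_map K L (KL : simplex K `<=` simplex L) n c :
  chain_map KL (@boundary K n c) = boundary (chain_map KL c).
Proof.
move: c; apply: (@eq_on_oriented _ _ _ (@chain_map K L KL n \o @boundary K n)
  (@boundary L n \o @chain_map K L KL n.+1)) => t /=.
rewrite chain_map_oriented !boundary_oriented linear_sum; apply: eq_bigr => i _.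
rewrite linearZ /= chain_map_oriented; congr (_ *: oriented _).
by apply: val_inj; apply: eq_from_tnth => j /=; rewrite !tnth_mktuple.
Qed.

Lemma face_face K n (t : tuples_in K n.+2) (i j : 'I_n.+2) : (i <= j)%N ->
  face i (face (fintype.lift ord0 j) t) = face j (face (widen_ord (leqnSn _) i) t).
Proof.
move=> ij; apply: val_inj; apply: eq_from_tnth => p /=.
rewrite !tnth_mktuple; congr (tnth _ _); apply: val_inj.
by rewrite /= /bump; lia.
Qed.

Lemma boundaryK K n (c : chains K n.+2) : boundary (boundary c) = 0.
Proof.
move: c.
apply: (@eq_on_oriented _ _ _ (@boundary K n \o @boundary K n.+1) \0) => t /=.
rewrite boundary_oriented linear_sum.
pose F (ij : 'I_n.+3 * 'I_n.+2) : chains K n :=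
  (-1) ^+ (ij.1 + ij.2) *: oriented (face ij.2 (face ij.1 t)).
transitivity (\sum_(i < n.+3) \sum_(j < n.+2) F (i, j)).
  apply: eq_bigr => i _; rewrite linearZ /= boundary_oriented scaler_sumr.
  by apply: eq_bigr => j _; rewrite scalerA -exprD.
rewrite pair_big (eq_bigr F); last by case.
rewrite (bigID (fun ij : 'I_n.+3 * 'I_n.+2 => (ij.1 <= ij.2)%N)) /=.
pose h (ij : 'I_n.+3 * 'I_n.+2) : 'I_n.+3 * 'I_n.+2 :=
  (fintype.lift ord0 ij.2, inord ij.1).
pose h' (ij : 'I_n.+3 * 'I_n.+2) : 'I_n.+3 * 'I_n.+2 :=
  (widen_ord (leqnSn _) ij.2, inord ij.1.-1).
rewrite [X in _ + X](reindex_onto h h'); last first.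
  move=> [i j] /=; rewrite -ltnNge => ji.
  congr (_, _); apply: val_inj; rewrite /= /bump ?inordK ?leq0n ?add1n //=.
    by have := ltn_ord i; lia.
  by have := ltn_ord i; lia.
rewrite [X in _ + X](eq_bigl (fun ij : 'I_n.+3 * 'I_n.+2 => (ij.1 <= ij.2)%N)).
  rewrite -big_split big1 // => -[i j] /= ij.
  have iE : widen_ord (leqnSn _) (inord i : 'I_n.+2) = i.
    by apply: val_inj; rewrite /= inordK //; have := ltn_ord j; lia.
  have iK : (inord i : 'I_n.+2) = i :> nat by rewrite -[in RHS]iE.
  rewrite /F /h /= face_face ?iK // iE /bump leq0n add1n addSn exprS mulN1r.
  by rewrite scaleNr addnC subrr.
move=> [i j] /=; rewrite /bump leq0n add1n.
case: (leqP i j) => ij.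
  have iK : (inord i : 'I_n.+2) = i :> nat.
    by rewrite inordK //; have := ltn_ord j; lia.
  rewrite iK -ltnNge ltnS ij /=; apply/eqP; congr (_, _); apply: val_inj => //=.
  by rewrite inord_val.
apply/negbTE/negP => /andP[ji /eqP[/(congr1 val) /= iK _]].
by move: ji; rewrite iK; lia.
Qed.

Definition H1_map K L (KL : simplex K `<=` simplex L) : H1 K -> H1 L :=
  homology_map (@boundary_chain_map K L KL 1) (@boundary_chain_map K L KL 0).

HB.instance Definition _ K L (KL : simplex K `<=` simplex L) :=
  GRing.Linear.on (@H1_map K L KL).

Lemma chain_map_id K (KK : simplex K `<=` simplex K) n (c : chains K n) :
  chain_map KK c = c.
Proof.
move: c; apply: (@eq_on_oriented _ _ _ (@chain_map K K KK n) idfun) => t /=.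
by rewrite chain_map_oriented; congr oriented; exact: val_inj.
Qed.

Lemma chain_map_comp K L M (KL : simplex K `<=` simplex L)
    (LM : simplex L `<=` simplex M) (KM : simplex K `<=` simplex M)
    n (c : chains K n) :
  chain_map KM c = chain_map LM (chain_map KL c).
Proof.
move: c; apply: (@eq_on_oriented _ _ _ (@chain_map K M KM n)
  (@chain_map L M LM n \o @chain_map K L KL n)) => t.
rewrite -[LHS]/(chain_map KM (oriented t)).
rewrite -[RHS]/(chain_map LM (chain_map KL (oriented t))).
rewrite !chain_map_oriented; congr oriented; exact: val_inj.
Qed.

Lemma H1_mapE K L (KL : simplex K `<=` simplex L) z :
  H1_map KL (to_quot (boundaries (@boundary K 1) (@boundary K 0)) z) =
  to_quot (boundaries (@boundary L 1) (@boundary L 0))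
    (cycles_map (@boundary_chain_map K L KL 0) z).
Proof. exact: homology_mapE. Qed.

Lemma H1_map_id K (KK : simplex K `<=` simplex K) x : H1_map KK x = x.
Proof.
rewrite -[x]to_quot_repr; move: (repr x) => z.
rewrite H1_mapE; congr (to_quot _ _).
by apply: val_inj; exact: (chain_map_id KK (val z)).
Qed.

Lemma H1_map_comp K L M (KL : simplex K `<=` simplex L)
    (LM : simplex L `<=` simplex M) (KM : simplex K `<=` simplex M) x :
  H1_map KM x = H1_map LM (H1_map KL x).
Proof.
rewrite -[x]to_quot_repr; move: (repr x) => z.
rewrite (H1_mapE KM) (H1_mapE KL) (H1_mapE LM); congr (to_quot _ _).
by apply: val_inj; exact: (chain_map_comp KL LM KM (val z)).
Qed.

End OrientedChains.

Arguments H1 k {X} K.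
Arguments H1_map k {X K L} KL x.

Record persistence_module (R : realType) (k : fieldType) := PersistenceModule {
  pm_space :> R -> lmodType k;
  pm_map : forall a b : R, a <= b -> {linear pm_space a -> pm_space b};
  pm_map_id : forall (a : R) (aa : a <= a) x, pm_map aa x = x;
  pm_map_comp : forall (a b c : R) (ab : a <= b) (bc : b <= c) (ac : a <= c) x,
    pm_map ac x = pm_map bc (pm_map ab x)
}.

Section Diagram.
Context (R : realType) (k : fieldType) (V : persistence_module R k).
Local Open Scope ereal_scope.

(* V extended to the extended real line by V_{-oo} = V_{+oo} = 0. *)
Definition ext_space (a : \bar R) : lmodType k :=
  if a is r%:E then V r else 'rV[k]_0.

Definition ext_map (a b : \bar R) : a <= b -> {linear ext_space a -> ext_space b} :=
  match a, b with
  | r%:E, s%:E => fun rs => pm_map V (rs : (r <= s)%R)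
  | _, _ => fun=> \0%R
  end.

Record rectangle := Rectangle {
  rect_p : \bar R; rect_q : \bar R; rect_r : \bar R; rect_s : \bar R;
  rect_pq : rect_p < rect_q;
  rect_qr : rect_q < rect_r;
  rect_rs : rect_r < rect_s
}.

Definition rectangle_set (Q : rectangle) : set (\bar R * \bar R) :=
  [set z | rect_p Q <= z.1 <= rect_q Q /\ rect_r Q <= z.2 <= rect_s Q].

Section Measure.
Context (Q : rectangle).

Let pr : rect_p Q <= rect_r Q := ltW (lt_trans (rect_pq Q) (rect_qr Q)).
Let qr : rect_q Q <= rect_r Q := ltW (rect_qr Q).
Let rs : rect_r Q <= rect_s Q := ltW (rect_rs Q).

Definition numerator : submodClosed (ext_space (rect_r Q)) :=
  cap (im (ext_map qr)) (ker (ext_map rs)).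

Definition denominator : submodClosed (ext_space (rect_r Q)) :=
  cap (im (ext_map pr)) (ker (ext_map rs)).

(* Multiplicity, in V_p -> V_q -> V_r -> V_s, of the interval summand supported
   exactly at the positions q and r: the dimension of
   (im v_q^r `&` ker v_r^s) / (im v_p^r `&` ker v_r^s). *)
Definition mu : \bar R :=
  dimension R (quot_space (preim (@sub_val _ _ numerator) denominator)).

End Measure.

(* The diagram is defined, and empty, away from A. *)
Definition diagram_contained (A : set (\bar R * \bar R)) :=
  forall Q, rectangle_set Q `&` A = set0 -> mu Q = 0.

End Diagram.

Section Rips.
Context (R : realType) (X : metricType R).

Definition rips_simplex (a : R) : set {fset X} :=
  [set A | A != fset0 /\ forall x y, x \in A -> y \in A -> mdist x y <= a].

Lemma rips_neq0 a A : rips_simplex a A -> A != fset0.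
Proof. by case. Qed.

Lemma rips_sub a A B : rips_simplex a A -> (B `<=` A)%fset -> B != fset0 ->
  rips_simplex a B.
Proof.
by move=> [_ Aa] /fsubsetP BA B0; split=> // x y xB yB; apply: Aa; exact: BA.
Qed.

Definition rips (a : R) : simplicial_complex X :=
  SimplicialComplex (@rips_neq0 a) (@rips_sub a).

Lemma rips_mono a b : a <= b -> simplex (rips a) `<=` simplex (rips b).
Proof.
by move=> ab A [A0 Aa]; split=> // x y xA yA; exact: le_trans (Aa _ _ xA yA) ab.
Qed.

Definition H1_rips (k : fieldType) : persistence_module R k :=
  @PersistenceModule R k (fun a => H1 k (rips a))
    (fun a b ab => H1_map k (rips_mono ab))
    (fun a aa => H1_map_id (rips_mono aa))
    (fun a b c ab bc ac => H1_map_comp (rips_mono ab) (rips_mono bc) (rips_mono ac)).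

Definition polygonal_length (f : R -> X) (a : R) (s : seq R) : R :=
  \sum_(0 <= i < size s) mdist (f (nth a (a :: s) i)) (f (nth a (a :: s) i.+1)).

(* The length of the curve f : [0, 1] -> X, possibly +oo. *)
Definition curve_length (f : R -> X) : \bar R :=
  ereal_sup [set (polygonal_length f 0 s)%:E | s in itv_partition 0 1].

Definition curves (x y : X) : set (R -> X) :=
  [set f : R -> X | {within `[0, 1], continuous f} /\ f 0 = x /\ f 1 = y].

Definition path_metric_space : Prop :=
  forall x y : X, (mdist x y)%:E = ereal_inf [set curve_length f | f in curves x y].

End Rips.

Arguments path_metric_space {R} X.
Arguments H1_rips {R} X k.

(* Main.v *)
From HB Require Import structures.
Require Import Defs.
From mathcomp Require Import all_boot all_order all_algebra perm finmap.
From mathcomp Require Import all_classical all_reals all_analysis.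
From mathcomp Require Import lra.

Import Order.TTheory GRing.Theory Num.Theory.
Import numFieldNormedType.Exports.

Local Open Scope classical_set_scope.
Local Open Scope ring_scope.

(** In a path metric space every edge can be cut into two edges of length at
    most 2/3 of the original: a nearly shortest curve from [x] to [y] contains,
    by the intermediate value theorem, a point [m] at distance exactly
    [d(x,y)/2] from [x], and the rest of the curve is then not much longer
    ([near_midpoint]). If [d(x,y) <= q], the triangle [x, m, y] has diameter at
    most [q], so [[x,y]] is homologous to [[x,m] + [m,y]] inside [Rips(X,q)].
    Applied to all the edges of a cycle, this shows that
    [H1(Rips(X,p)) -> H1(Rips(X,q))] is onto when [0 <= p <= q] and
    [(2/3) q <= p]; the argument is carried out for any inclusion of complexes
    whose edges can be subdivided ([H1_map_onto]). Iterating, the map is onto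
    for all [0 < p <= q] ([rips_onto]).

    Hence no class is born at a positive time. None is born at a negative time
    either, because [Rips(X,a)] is empty for [a < 0] ([H1_rips_neg]). The
    multiplicity of a rectangle [[p,q] x [r,s]] vanishes as soon as the image of
    [V_q] in [V_r] comes from [V_p] ([mu_eq0]), which is the case if [q < 0] or
    [p > 0]. In the remaining case [p <= 0 <= q < r < +oo], and the rectangle
    contains the point [(0, r)] of the vertical half-line. *)

(** * Almost-midpoints in path metric spaces *)

Lemma continuous_dist_curve {R : realType} {X : metricType R} (x : X) (f : R -> X) :
  {within `[0, 1], continuous f} ->
  {within `[0, 1], continuous (fun t => mdist x (f t))}.
Proof.
move=> fc t; apply/cvgrPdist_lt => e e0.
have /metricType_numDomainType.cvgr_dist_lt/(_ _ e0) := fc t.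
apply: filterS => s /= fts.
rewrite /from_subspace /= in fts *.
have h1 := metric_triangle x (f t) (f s).
have h2 := metric_triangle x (f s) (f t).
rewrite (metric_sym (f s) (f t)) in h2.
by rewrite ltr_norml; apply/andP; split; lra.
Qed.

Lemma curve_length_ge2 {R : realType} {X : metricType R} (f : R -> X) (t : R) :
  0 < t < 1 ->
  ((mdist (f 0) (f t) + mdist (f t) (f 1))%:E <= curve_length f)%E.
Proof.
move=> /andP[t0 t1]; apply: ereal_sup_ubound; exists [:: t; 1].
  by split=> //=; rewrite t0 t1.
by rewrite /polygonal_length /= big_nat_recr//= big_nat1.
Qed.

(** The exact midpoint need not exist, as the infimum of the lengths need not be
    attained; any ratio in the open interval from 1/2 to 1 would do in place of
    2/3. *)
Lemma near_midpoint {R : realType} {X : metricType R} (x y : X) :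
  path_metric_space X ->
  exists m, mdist x m <= 2/3 * mdist x y /\ mdist m y <= 2/3 * mdist x y.
Proof.
move=> hX; set d := mdist x y.
have [d0|d0] := leP d 0.
  have dE : d = 0 by apply/eqP; rewrite eq_le d0 mdist_ge0.
  by exists x; rewrite mdistxx -/d dE mulr0.
(* 7/6 = 1/2 + 2/3: the first half of the curve uses up at least d/2, and at
   most 2/3 d is left for the second half. *)
have dlt : (ereal_inf [set curve_length f | f in curves x y] < (7/6 * d)%:E)%E.
  by rewrite -hX lte_fin -/d; lra.
have [_ [f [fc [f0 f1]] <-] lf] := ereal_inf_lt dlt.
have [|t tI ft] := @IVT _ (fun t => mdist x (f t)) 0 1 (d/2) ler01
    (continuous_dist_curve x f fc).
  by rewrite f0 f1 mdistxx -/d ge_min le_max; apply/andP; split; apply/orP;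
    [left|right]; lra.
have t01 : 0 < t < 1.
  move: tI; rewrite in_itv /= => /andP[t0 t1]; rewrite !lt_neqAle t0 t1 !andbT.
  apply/andP; split; apply/eqP => tE.
    by move: ft; rewrite -tE f0 mdistxx; lra.
  by move: ft; rewrite tE f1 -/d; lra.
have := le_lt_trans (curve_length_ge2 f t t01) lf.
rewrite lte_fin f0 f1 ft => hd; exists (f t).
by rewrite ft; split; lra.
Qed.

(** * Vanishing of the multiplicity of a rectangle *)

Lemma dimension_trivial (R : realType) (k : fieldType) (V : lmodType k) :
  (forall v : V, v = 0) -> dimension R V = 0%E.
Proof.
move=> V0; have z (e : 'I_0 -> V) : lin_indep e by move=> c _ [].
rewrite /dimension; suff -> : [set n%:R%:E | n in
   [set n | exists e : 'I_n -> V, lin_indep e]] = [set (0%E : \bar R)].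
  exact: ereal_sup1.
apply/seteqP; split=> [_ [[|n] [e eI] <-]//|_ ->].
  have /(_ ord0)/eqP := eI (fun=> 1) (V0 _).
  by rewrite oner_eq0.
by exists 0%N => //; exists (fun=> 0).
Qed.

(** The numerator and the denominator of the multiplicity are the traces on
    [ker v_r^s] of the images of [V_q] and [V_p] in [V_r]. *)
Lemma mu_eq0 (R : realType) (k : fieldType) (V : persistence_module R k)
    (Q : rectangle R) :
  (forall (pr : (rect_p Q <= rect_r Q)%E) (qr : (rect_q Q <= rect_r Q)%E) u,
    exists w, ext_map V pr w = ext_map V qr u) ->
  mu V Q = 0%E.
Proof.
move=> imV; apply: dimension_trivial => x.
rewrite -[x]to_quot_repr -(linear0 (to_quot _)); apply/to_quotP.
rewrite subr0; have /andP[/asboolP[u uv] v0] := valP (repr x).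
apply/andP; split=> //; apply/asboolP.
by have [w wE] := imV (ltW (lt_trans (rect_pq Q) (rect_qr Q))) (ltW (rect_qr Q)) u;
  exists w; rewrite wE; exact: uv.
Qed.

(** * Surjectivity on first homology by subdivision of edges *)

Section Vertices.
Context (k : fieldType) (X : choiceType) (K L : simplicial_complex X).
Hypothesis LK : forall t : 1.-tuple X,
  t \in tuples_in L (n:=0) -> t \in tuples_in K (n:=0).

Definition vertex_back (t : tuples_in L (n:=0)) : tuples_in K (n:=0) :=
  exist (fun u => u \in tuples_in K (n:=0)) (val t) (LK _ (valP t)).

Definition free_vertex_back : free_chains k L 0 -> free_chains k K 0 :=
  lin_ext (fun t => gen k (vertex_back t)).

HB.instance Definition _ := GRing.Linear.on free_vertex_back.

(** In degree 0 the orientation relations are all trivial: a 1-tuple has neither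
    a repeated entry nor an odd permutation. *)
Lemma free_vertex_back_rel c :
  c \in Defs.span (@orientation_relations k _ L 0) ->
  free_vertex_back c \in Defs.span (@orientation_relations k _ K 0).
Proof.
move: c; apply: (@Defs.span_min _ _ _ (Defs.preim free_vertex_back _)) => c cr.
suff -> : c = 0 by exact: rpred0.
case: cr => [[[[[|x []]//= sz] tK]] //|[s [t ->]]].
have -> : s = perm_one _.
  by apply/permP => i; rewrite !ord1.
rewrite odd_perm1 expr0 scale1r; apply/eqP; rewrite subr_eq0; apply/eqP.
congr gen; apply/val_inj/eq_from_tnth => i /=.
by rewrite tnth_mktuple perm1.
Qed.

(** Sending each vertex of [L] to itself, seen in [K], is a retraction of the
    chain map. *)
Lemma chain_map0_inj (KL : simplex K `<=` simplex L) (c : chains k K 0) :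
  chain_map KL c = 0 -> c = 0.
Proof.
pose g := quot_map free_vertex_back free_vertex_back_rel.
suff gK : g \o chain_map KL (n:=0) =1 (@idfun (chains k K 0)).
  by move=> c0; rewrite -[c]gK /= c0 /g linear0.
apply: eq_on_oriented => t /=.
rewrite chain_map_oriented /g /oriented quot_mapE; congr to_quot.
rewrite [LHS]lin_extE; congr gen; exact: val_inj.
Qed.
End Vertices.

(** Write a cycle of the target as [fV v + d1' u]. Then [fW (d0 v) = d0' (fV v)]
    vanishes, so injectivity of [fW] makes [v] itself a cycle, and the class of
    [v] is a preimage. *)
Lemma homology_map_onto (k : fieldType) (U V W U' V' W' : lmodType k)
    (d1 : {linear U -> V}) (d0 : {linear V -> W})
    (d1' : {linear U' -> V'}) (d0' : {linear V' -> W'})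
    (fU : {linear U -> U'}) (fV : {linear V -> V'}) (fW : {linear W -> W'})
    (f1 : forall u, fV (d1 u) = d1' (fU u))
    (f0 : forall v, fW (d0 v) = d0' (fV v)) :
  (forall w, fW w = 0 -> w = 0) -> (forall u, d0' (d1' u) = 0) ->
  (forall v', exists v u', v' = fV v + d1' u') ->
  forall x, exists y, homology_map f1 f0 y = x.
Proof.
move=> fW_inj dd fVd x.
rewrite -[x]to_quot_repr; move: (repr x) => z.
have [v [u zE]] := fVd (val z).
have vC : v \in ker d0.
  apply/eqP/fW_inj; rewrite f0 -[fV v](addrK (d1' u)) -zE linearB dd subr0.
  exact/eqP/(valP z).
pose zv : cycles d0 := exist (fun w => w \in ker d0) v vC.
exists (to_quot _ zv); rewrite homology_mapE; apply/to_quotP/asboolP.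
by exists (- u); rewrite linearN linearB /= /sub_val zE opprD addrA subrr sub0r.
Qed.

Section Subdivision.
Context (k : fieldType) (X : choiceType) (K L : simplicial_complex X).
Hypothesis KL : simplex K `<=` simplex L.
Hypothesis LK : forall t : 1.-tuple X,
  t \in tuples_in L (n:=0) -> t \in tuples_in K (n:=0).
Hypothesis subdivide : forall x y, [tuple x; y] \in tuples_in L (n:=1) ->
  exists m, [/\ [tuple x; m] \in tuples_in K (n:=1),
    [tuple m; y] \in tuples_in K (n:=1) & [tuple x; m; y] \in tuples_in L (n:=2)].

(** The boundary of [[x,m,y]] is [[m,y] - [x,y] + [x,m]]. *)
Lemma edge_subdivision (t : tuples_in L (n:=1)) :
  exists c b, oriented k t = chain_map KL c + boundary (b : chains k L 2).
Proof.
pose x := tnth (val t) ord0; pose y := tnth (val t) (lift ord0 ord0).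
have tE : val t = [tuple x; y].
  by rewrite /x /y; case: (val t) => [[|a [|b []]]]// sz;
    apply/val_inj; rewrite /= !(tnth_nth a).
have tL : [tuple x; y] \in tuples_in L (n:=1) by rewrite -tE; exact: (valP t).
have [m [xm my xmy]] := subdivide x y tL.
pose txm : tuples_in K (n:=1) := exist (fun u => u \in tuples_in K (n:=1)) _ xm.
pose tmy : tuples_in K (n:=1) := exist (fun u => u \in tuples_in K (n:=1)) _ my.
pose txmy : tuples_in L (n:=2) := exist (fun u => u \in tuples_in L (n:=2)) _ xmy.
have face0 : face ord0 txmy = include KL tmy.
  by apply/val_inj/eq_from_tnth => -[[|[|]]//= i]; rewrite tnth_mktuple.
have face1 : face (lift ord0 ord0) txmy = t.
  apply: val_inj; rewrite tE.
  by apply: eq_from_tnth => -[[|[|]]//= i]; rewrite tnth_mktuple.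
have face2 : face (lift ord0 (lift ord0 ord0)) txmy = include KL txm.
  by apply/val_inj/eq_from_tnth => -[[|[|]]//= i]; rewrite tnth_mktuple.
exists (oriented k txm + oriented k tmy), (- oriented k txmy).
have -> : boundary (- oriented k txmy) = - boundary (oriented k txmy).
  exact: (raddfN (@boundary k X L 1)).
have -> : chain_map KL (oriented k txm + oriented k tmy) =
    chain_map KL (oriented k txm) + chain_map KL (oriented k tmy).
  exact: (raddfD (@chain_map k X K L KL 1)).
rewrite boundary_oriented !chain_map_oriented !big_ord_recl big_ord0.
rewrite face0 face1 face2.
rewrite addr0 expr0 expr1 sqrrN expr1n !scale1r scaleN1r.
by rewrite opprD addrA addrK opprD opprK addrC subrK.
Qed.

(** Both sides being linear, the point [m] may be chosen for each edge
    separately, with no compatibility between an edge and its reverse. *)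
Lemma chain_subdivision (c : chains k L 1) :
  exists c' b, c = chain_map KL c' + boundary (b : chains k L 2).
Proof.
rewrite -[c]to_quot_repr; move: (repr c); apply: free_ind.
  exists 0, 0; rewrite (linear0 (@chain_map k X K L KL 1)).
  by rewrite (linear0 (@boundary k X L 1)) addr0; exact: (linear0 (to_quot _)).
move=> a t d [c' [b dE]]; have [ct [bt tE]] := edge_subdivision t.
exists (a *: ct + c'), (a *: bt + b).
rewrite (linearP (@chain_map k X K L KL 1)) (linearP (@boundary k X L 1)).
transitivity (a *: oriented k t +
  to_quot (Defs.span (@orientation_relations k _ L 1)) d).
  exact: (linearP (to_quot _)).
by rewrite dE tE scalerDr addrACA.
Qed.

Lemma H1_map_onto (x : H1 k L) : exists y, H1_map k KL y = x.
Proof.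
apply: homology_map_onto; last exact: chain_subdivision.
- exact: chain_map0_inj.
- exact: boundaryK.
Qed.
End Subdivision.

(** * Rips complexes *)

Section RipsMaps.
Context (R : realType) (k : fieldType) (X : metricType R).

Lemma tuples_in_rips n (a : R) (t : n.+1.-tuple X) :
  t \in tuples_in (rips X a) (n:=n) <->
  (forall x y, x \in t -> y \in t -> mdist x y <= a).
Proof.
rewrite inE /tuples_in /=; split=> [[_ ta] x y xt yt|ta].
  by apply: ta; rewrite !inE.
split; last by move=> x y; rewrite !inE; exact: ta.
by apply/fset0Pn; exists (thead t); rewrite !inE mem_tnth.
Qed.

Lemma rips_step (p q : R) (pq : p <= q) :
  path_metric_space X -> 0 <= p -> 2/3 * q <= p ->
  forall x, exists y, pm_map (H1_rips X k) pq y = x.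
Proof.
move=> hX p0 hp; apply: H1_map_onto.
  move=> t _; apply/tuples_in_rips => x y.
  by case: t => [[|a []]]//= sz; rewrite !inE => /eqP -> /eqP ->; rewrite mdistxx.
move=> x y /tuples_in_rips xyq.
have dq : mdist x y <= q by apply: xyq; rewrite !inE eqxx ?orbT.
have [m [xm my]] := near_midpoint x y hX.
have xmp : mdist x m <= p by lra.
have myp : mdist m y <= p by lra.
exists m; split; apply/tuples_in_rips => u v; rewrite !inE.
- by move=> /orP[]/eqP-> /orP[]/eqP->; rewrite ?mdistxx// metric_sym.
- by move=> /orP[]/eqP-> /orP[]/eqP->; rewrite ?mdistxx// metric_sym.
- have q0 : 0 <= q by lra.
  have xmq : mdist x m <= q by lra.
  have myq : mdist m y <= q by lra.
  by move=> /or3P[]/eqP-> /or3P[]/eqP->; rewrite ?mdistxx// metric_sym.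
Qed.

(** Some power of 2/3 shrinks [q] below [p]; the map is then a composite of
    finitely many maps covered by [rips_step]. *)
Lemma rips_onto (p q : R) (pq : p <= q) :
  path_metric_space X -> 0 < p ->
  forall x, exists y, pm_map (H1_rips X k) pq y = x.
Proof.
move=> hX p0.
have [n hn] : exists n, (2/3) ^+ n * q <= p.
  have q0 : 0 < q by lra.
  have z1 : `|2/3 : R| < 1 by rewrite ger0_norm; lra.
  have /cvgrPdist_lt/(_ _ (divr_gt0 p0 q0)) [n _ /(_ n (leqnn n))] := cvg_expr z1.
  rewrite /= sub0r normrN ger0_norm; last by apply: exprn_ge0; lra.
  by rewrite ltr_pdivlMr// => /ltW ?; exists n.
elim: n q pq hn => [|n IH] q pq hn x.
  rewrite expr0 mul1r in hn; have pqE : p = q by apply/eqP; rewrite eq_le pq.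
  by subst q; exists x; exact: pm_map_id.
(* The factor 2/3 may overshoot p, so the intermediate scale is cut off at p. *)
pose q' := Num.max p (2/3 * q).
have pq' : p <= q' by rewrite le_max lexx.
have q'q : q' <= q by rewrite ge_max pq; lra.
have q'2 : 2/3 * q <= q' by rewrite le_max lexx orbT.
have q'0 : 0 <= q' by lra.
have [z zx] := rips_step q' q q'q hX q'0 q'2 x.
have hn' : (2/3) ^+ n * q' <= p.
  rewrite /q' maxEle; case: ifP => _; first by rewrite mulrA -exprSr.
  by rewrite ler_piMl ?(ltW p0)//; apply: exprn_ile1; lra.
have [y yz] := IH q' pq' hn' z.
exists y; rewrite (pm_map_comp pq' q'q pq y) yz; exact: zx.
Qed.

(** A vertex [x] belongs to [Rips(X,a)] only if [d(x,x) = 0 <= a]. *)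
Lemma H1_rips_neg (a : R) (x : H1_rips X k a) : a < 0 -> x = 0.
Proof.
move=> a0; rewrite -[x]to_quot_repr -(linear0 (to_quot _)); apply/to_quotP.
rewrite subr0; move: (repr x) => z; apply/asboolP; exists 0.
rewrite linear0; symmetry.
apply: (@eq_on_oriented k _ (rips X a) 1 _ idfun \0) => t /=.
have /tuples_in_rips/(_ (thead (val t)) (thead (val t))) := valP t.
by rewrite mdistxx leNgt a0 => /(_ (mem_tnth _ _) (mem_tnth _ _)).
Qed.

End RipsMaps.

Theorem theorem6p3 (R : realType) (k : fieldType) (X : metricType R)
    (hX : path_metric_space X) :
  diagram_contained (H1_rips X k) ([set 0%E] `*` [set y | (0 <= y < +oo)%E]).
Proof.
case=> p q r s pq qr rs.
(* The strict inequalities leave only finite values for q and r. *)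
have := (pq, qr, rs); case: q r pq qr rs => [q| |] [r| |] pq qr rs [[]];
  rewrite ?(ltNge _ -oo%E, ltNge +oo%E) ?(leey, leNye)//.
move=> pq' qr' _ QA; apply: mu_eq0 => /= pr qr'' u.
have [q0|q0] := ltP q 0.
  have u0 : u = 0 by exact: H1_rips_neg.
  exists 0; rewrite u0; transitivity (0 : H1_rips X k r).
    exact: raddf0.
  symmetry; exact: raddf0.
(* If p <= 0 <= q, the rectangle would meet the half-line at (0, r). *)
have [p0|p0] := leP p 0%E.
  suff : ([set 0%E] `*` [set y : \bar R | (0 <= y < +oo)%E] : set _) (0%E, r%:E).
    move=> Ar; suff : set0 (0%E : \bar R, r%:E) by [].
    rewrite -QA; split=> //; split=> /=; rewrite ?p0 ?lee_fin ?q0 ?lexx//;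
      exact: ltW.
  split=> //=; rewrite ltry lee_fin andbT (le_trans q0)// -lee_fin; exact: ltW.
move: p0 pq' pr; case: p {pq QA} => [p| |]//; rewrite lte_fin => p0 pq pr.
have pq' : p <= q by rewrite -lee_fin; exact: ltW.
have [w wu] := rips_onto R k X p q pq' hX p0 u.
exists w; rewrite -wu.
exact: (@pm_map_comp R k (H1_rips X k) p q r pq' qr'' pr w).
Qed.
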